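(* (Conservation of mass of the branch model.) Let $\alpha_j,\beta_j,\kappa_j,\gamma_j\in\mathbb R$ ($j=0,1,2$) with all $\alpha_j\ne0$, $\beta_j\neq0$, and consider the system $\dot x=Ax+Bu$, $y=Cx$ with $$A=\begin{bmatrix}0&0&0&-\alpha_0&\alpha_0&\alpha_0\\ 0&0&0&0&-\alpha_1&0\\ 0&0&0&0&0&-\alpha_2\\ \beta_0&0&0&\gamma_0&0&0\\ \kappa_1&\beta_1&0&0&\gamma_1&0\\ \kappa_2&0&\beta_2&0&0&\gamma_2\end{bmatrix},\quad B=\begin{bmatrix}0&0&0\\ 0&\alpha_1&0\\ 0&0&\alpha_2\\ \kappa_0&0&0\\ 0&0&0\\ 0&0&0\end{bmatrix},\quad C=\begin{bmatrix}0&1&0&0&0&0\\ 0&0&1&0&0&0\\ 0&0&0&1&0&0\end{bmatrix},$$ with input $u=\begin{bmatrix}p_{0,\ell}&q_{1,r}&q_{2,r}\end{bmatrix}^\top$ and output $y=\begin{bmatrix}p_{1,r}&p_{2,r}&q_{0,\ell}\end{bmatrix}^\top$. Then the system satisfies conservation of mass: writing its transfer function as $T(s)=C(sI-A)^{-1}B=\begin{bmatrix}T_{pp}(s)&T_{pq}(s) \\ {T_{qp}(s)}&T_{qq}(s)\end{bmatrix}$, with $T_{qp}$ the $1\times1$ block from $p_{0,\ell}$ to $q_{0,\ell}$ and $T_{qq}$ the $1\times2$ block from $(q_{1,r},q_{2,r})$ to $q_{0,\ell}$, one has $T_{qp}(0)=0$ and $T_{qq}(0)=\begin{bmatrix}1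&1\end{bmatrix}$.
   Context: The state is $x=\begin{bmatrix}p_{0,r}&p_{1,r}&p_{2,r}&q_{0,\ell}&q_{1,\ell}&q_{2,\ell}\end{bmatrix}^\top$; $p_{j,\ell},p_{j,r}$ are pressures and $q_{j,\ell},q_{j,r}$ mass flows (deviations from nominal values) at the left and right ends of pipe $P_j$, where pipe $P_0$ splits into $P_1$ and $P_2$. In the application $\alpha_j=-\frac{R_sT_0z_0}{A_jX_j}$ and $\beta_j=-\frac{A_j}{X_j}$ with all physical parameters positive. Conservation of mass for a model means that at zero frequency the total mass flow determined by the flow outputs does not depend on the pressure inputs and equals the sum of the flow inputs, i.e. $\mathbf 1T_{qp}(0)=\mathbf 0$ and $\mathbf 1T_{qq}(0)=\mathbf 1$ with $\mathbf 1,\mathbf 0$ row vectors of ones and zeros of appropriate size. *)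

(* Defs.v *)
From HB Require Import structures.
From mathcomp Require Import all_boot all_order all_algebra.
From mathcomp Require Import complex.
From mathcomp Require Import reals.

Set Implicit Arguments.
Unset Strict Implicit.
Unset Printing Implicit Defensive.

Import Order.TTheory GRing.Theory Num.Theory.
Local Open Scope ring_scope.
Local Open Scope complex_scope.

(* x' = A x + B u, y = C x, with n states, m inputs and p outputs. *)
Record lti_system (R : realType) (n m p : nat) := LTISystem {
  stateM : 'M[R]_n;
  inputM : 'M[R]_(n, m);
  outputM : 'M[R]_(p, n)
}.

Section Transfer.
Variables (R : realType) (n m p : nat).

Definition complex_mx k l (M : 'M[R]_(k, l)) : 'M[R[i]]_(k, l) :=
  map_mx (real_complex R) M.

Definition resolvent_mx (S : lti_system R n m p) (s : R[i]) : 'M[R[i]]_n :=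
  s%:M - complex_mx (stateM S).

(* invmx is total: the value at s is meaningful only where this holds. *)
Definition transfer_defined (S : lti_system R n m p) (s : R[i]) : bool :=
  resolvent_mx S s \in unitmx.

Definition transfer (S : lti_system R n m p) (s : R[i]) : 'M[R[i]]_(p, m) :=
  complex_mx (outputM S) *m invmx (resolvent_mx S s) *m complex_mx (inputM S).

End Transfer.

(* Inputs are ordered as mp pressures followed by mq flows, outputs as pp
   pressures followed by pq flows, so that T = [T_pp, T_pq; T_qp, T_qq]. *)
Section MassConservation.
Variables (R : realType) (mp mq pp pq : nat).
Variable T : R[i] -> 'M[R[i]]_(pp + pq, mp + mq).

Definition T_qp (s : R[i]) : 'M[R[i]]_(pq, mp) := dlsubmx (T s).
Definition T_qq (s : R[i]) : 'M[R[i]]_(pq, mq) := drsubmx (T s).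

Definition conserves_mass : Prop :=
  (const_mx 1 : 'rV_pq) *m T_qp 0 = 0 /\
  (const_mx 1 : 'rV_pq) *m T_qq 0 = const_mx 1.

End MassConservation.

Definition mx_of_rows (R : realType) (m n : nat) (rows : seq (seq R)) :
  'M[R]_(m, n) := \matrix_(i, j) nth 0 (nth [::] rows i) j.

Section Branch.
Variables (R : realType) (alpha beta kappa gamma : 'I_3 -> R).

(* State: (p_{0,r}, p_{1,r}, p_{2,r}, q_{0,l}, q_{1,l}, q_{2,l}). *)
Definition branch_A : 'M[R]_6 := mx_of_rows 6 6
  [:: [:: 0;       0;      0;      - alpha 0; alpha 0;   alpha 0];
      [:: 0;       0;      0;      0;         - alpha 1; 0];
      [:: 0;       0;      0;      0;         0;         - alpha 2];
      [:: beta 0;  0;      0;      gamma 0;   0;         0];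
      [:: kappa 1; beta 1; 0;      0;         gamma 1;   0];
      [:: kappa 2; 0;      beta 2; 0;         0;         gamma 2]].

(* Input: the pressure p_{0,l}, then the flows (q_{1,r}, q_{2,r}). *)
Definition branch_B : 'M[R]_(6, 1 + 2) := mx_of_rows 6 (1 + 2)
  [:: [:: 0;       0;       0];
      [:: 0;       alpha 1; 0];
      [:: 0;       0;       alpha 2];
      [:: kappa 0; 0;       0];
      [:: 0;       0;       0];
      [:: 0;       0;       0]].

(* Output: the pressures (p_{1,r}, p_{2,r}), then the flow q_{0,l}. *)
Definition branch_C : 'M[R]_(2 + 1, 6) := mx_of_rows (2 + 1) 6
  [:: [:: 0; 1; 0; 0; 0; 0];
      [:: 0; 0; 1; 0; 0; 0];
      [:: 0; 0; 0; 1; 0; 0]].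

Definition branch_system : lti_system R 6 (1 + 2) (2 + 1) :=
  LTISystem branch_A branch_B branch_C.

End Branch.

(* Main.v *)
(** The rows of [A] for the pressures express mass balance at zero frequency:
    dividing row [j] by [alpha_j] and adding the three rows up gives minus the
    row vector that reads off [q_{0,l}], so the [q_{0,l}]-row of [-C A^-1 B] is the
    same combination of the rows of [B], namely [0, 1, 1]. *)
Require Import Defs.
From mathcomp Require Import all_boot all_order all_algebra.
From mathcomp Require Import complex.
From mathcomp Require Import reals.

Import GRing.Theory Num.Theory.
Local Open Scope ring_scope.
Local Open Scope complex_scope.

Section ZeroFrequency.
Variables (R : realType) (n m p : nat) (S : lti_system R n m p).

Lemma resolvent_mx0 : resolvent_mx S 0 = complex_mx (- stateM S).
Proof. by rewrite /resolvent_mx raddf0 sub0r /complex_mx map_mxN. Qed.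

Lemma transfer_defined0 : transfer_defined S 0 = (stateM S \in unitmx).
Proof.
by rewrite /transfer_defined resolvent_mx0 map_unitmx -scaleN1r unitmxZ ?unitrN1.
Qed.

(** At [s = 0] the resolvent is the image of a real matrix, and [complex_mx] commutes with products
    and inverses, so the gain can be computed over [R]. *)
Lemma transfer0 :
  transfer S 0 =
  complex_mx (outputM S *m invmx (- stateM S) *m inputM S).
Proof. by rewrite /transfer resolvent_mx0 /complex_mx -map_invmx -!map_mxM. Qed.

End ZeroFrequency.

Section Branch.
Variables (R : realType) (alpha beta kappa gamma : 'I_3 -> R).
Hypothesis alpha_neq0 : forall j, alpha j != 0.

Let A := branch_A alpha beta kappa gamma.
Let B := branch_B alpha kappa.

Definition balance_row : 'rV[R]_6 :=
  \row_j [:: (alpha 0)^-1; (alpha 1)^-1; (alpha 2)^-1; 0; 0; 0]`_j.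

Lemma balance_rowA : balance_row *m (- A) = dsubmx (branch_C R).
Proof.
apply/rowP; case=> j lt_j; rewrite !mxE !big_ord_recl big_ord0 !mxE /=.
do 6?[case: j lt_j => [|j] lt_j //=];
  (* In columns 4 and 5, counted from 0, the sum is [-1 + 1]: the flow leaving pipe 0 cancels the
     flow entering pipe 1 or 2. *)
  by rewrite ?(oppr0, opprK, mulr0, mul0r, addr0, add0r, mulrN, mulVf) ?addNr.
Qed.

Lemma balance_rowB : balance_row *m B = row_mx 0 (const_mx 1) :> 'rV_(1 + 2).
Proof.
apply/rowP; case=> j lt_j; rewrite !mxE !big_ord_recl big_ord0 !mxE /=.
case: splitP => k /= ->; rewrite !mxE.
  by case: k => -[] //= _; rewrite !(mulr0, mul0r, addr0).
by case: k => -[|[]] //= _; rewrite !(mulr0, mul0r, addr0, add0r) mulVf.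
Qed.

Hypothesis beta_neq0 : forall j, beta j != 0.

(** In 3 by 3 blocks the diagonal of [A] is zero at the top left, and the two off-diagonal blocks
    are triangular with diagonals [- alpha j] and [beta j]. Hence a left kernel vector vanishes by
    back substitution. *)
Lemma branch_A_unit : A \in unitmx.
Proof.
rewrite -row_free_unit; apply: inj_row_free => v vA0.
have col j : (v *m A) 0 j = 0 by rewrite vA0 mxE.
have zero (x y : R) : y != 0 -> x * y = 0 -> x = 0.
  by move=> /negPf y0 /eqP; rewrite mulf_eq0 y0 orbF => /eqP.
have zeroN (x y : R) : y != 0 -> - (x * y) = 0 -> x = 0.
  by move=> y0 /eqP; rewrite oppr_eq0 => /eqP; apply: zero.
set o := fun k (h : (k < 6)%N) => Ordinal h.
have := col (@o 1%N isT); have := col (@o 2%N isT).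
have := col (@o 0%N isT); have := col (@o 3%N isT).
have := col (@o 4%N isT); have := col (@o 5%N isT).
rewrite !mxE !big_ord_recl !big_ord0 !mxE /= !(mulr0, addr0, add0r, mulrN).
(* Columns 1 and 2 have one nonzero entry each, which starts the elimination; column 0 then gives
   [v3], column 3 gives [v0], and columns 4 and 5 give [v1] and [v2]. *)
move=> c5 c4 c3 c0 /(zero _ _ (beta_neq0 _)) v5 /(zero _ _ (beta_neq0 _)) v4.
move: c0; rewrite v4 v5 !(mul0r, addr0) => /(zero _ _ (beta_neq0 _)) v3.
move: c3; rewrite v3 mul0r addr0 => /(zeroN _ _ (alpha_neq0 _)) v0.
move: c4; rewrite v0 v4 !(mul0r, addr0, add0r) => /(zeroN _ _ (alpha_neq0 _)) v1.
move: c5; rewrite v0 v5 !(mul0r, addr0, add0r) => /(zeroN _ _ (alpha_neq0 _)) v2.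
apply/rowP => j; rewrite mxE.
have : v 0 =1 (fun=> 0); last exact.
case=> k lt_k.
(* The indices in [v0], ..., [v5] are nested lifts left by [big_ord_recl]; they agree with the
   literal ordinals by value. *)
do 6?[case: k lt_k => [|k] lt_k //];
  [rewrite -[RHS]v0 | rewrite -[RHS]v1 | rewrite -[RHS]v2
  |rewrite -[RHS]v3 | rewrite -[RHS]v4 | rewrite -[RHS]v5];
  by congr (v _ _); apply: val_inj.
Qed.

Lemma branch_flow_gain :
  dsubmx (transfer (branch_system alpha beta kappa gamma) 0) =
  row_mx 0 (const_mx 1).
Proof.
(* Writing the flow row of [C] as [balance_row *m (- A)] makes the inverse cancel without being
   computed. *)
rewrite transfer0 /complex_mx -map_dsubmx -!mul_dsub_mx /= -balance_rowA.
rewrite mulmxK; last by rewrite -scaleN1r unitmxZ ?unitrN1 // branch_A_unit.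
by rewrite balance_rowB map_row_mx map_mx0 map_const_mx rmorph1.
Qed.

End Branch.

Theorem mainTheorem7 (R : realType) (alpha beta kappa gamma : 'I_3 -> R)
    (halpha : forall j, alpha j != 0) (hbeta : forall j, beta j != 0) :
  let S := branch_system alpha beta kappa gamma in
  let T : R[i] -> 'M[R[i]]_(2 + 1, 1 + 2) := transfer S in
  [/\ transfer_defined S 0,
      conserves_mass T,
      T_qp T 0 = 0 &
      T_qq T 0 = const_mx 1].
Proof.
move=> S T.
have gain := branch_flow_gain _ _ _ kappa gamma halpha hbeta.
have Tqp : T_qp T 0 = 0 by rewrite /T_qp /dlsubmx gain row_mxKl.
have Tqq : T_qq T 0 = const_mx 1 by rewrite /T_qq /drsubmx gain row_mxKr.
split=> //; first by rewrite transfer_defined0 branch_A_unit.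
split; first by rewrite Tqp mulmx0.
(* There is a single flow output, so the row of ones on the left is the scalar 1. *)
by rewrite Tqq; apply/matrixP => i j; rewrite !mxE big_ord1 !mxE mulr1.
Qed.
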